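(* Let $G$ be a finite group. Then $\ell\mathbf{EAS}'(\mathbb{K}G)$ is isomorphic to $\ell\mathbf{EAS}\bigl(\mathbb{K}^G\bigr)$, and $\ell\mathbf{EAS}'\bigl(\mathbb{K}^G\bigr)$ is isomorphic to $\ell\mathbf{EAS}(\mathbb{K}G^{\mathrm{op}})$.
   Context: $\mathbb{K}$ is a commutative field. $\mathbb{K}G$ is the group Hopf algebra of $G$ (with $\Delta(g)=g\otimes g$ and $S(g)=g^{-1}$ for $g\in G$), $G^{\mathrm{op}}$ is the opposite group, and $\mathbb{K}^G$ is the Hopf algebra of functions on $G$, dual of $\mathbb{K}G$, with basis $(\delta_g)_{g\in G}$ dual to the basis $G$ of $\mathbb{K} G$: $\delta_g\delta_h=\delta_{g}$ if $g=h$ and $0$ otherwise, $\Delta(\delta_g)=\sum_{g_1g_2=g}\delta_{g_1}\otimes\delta_{g_2}$, $S(\delta_g)=\delta_{g^{-1}}$. For a bialgebra $A$, $\ell\mathbf{EAS}(A)$ is the pair $(A,\Phi)$ with $\Phi(a\otimes b)=\sum a^{(1)}b\otimes a^{(2)}$. For a Hopf algebra $A$ of antipode $S$, $\ell\mathbf{EAS}'(A)$ is the pair $(A,\Phi)$ with $\Phi(a\otimes b)=\sum b^{(1)}\otimes S(b^{(2)})a$. Here $\Delta(a)=\sum a^{(1)}\otimes a^{(2)}$. An isomorphism $(A,\Phi)\to(B,\Psi)$ is a linear bijection $f\colon A\to B$ with $(f\otimes f)\circ\Phi=\Psi\circ(f\otimes f)$. *)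

(* Defs.v *)
From HB Require Import structures.
From mathcomp Require Import all_boot all_algebra all_fingroup all_field.

Set Implicit Arguments.
Unset Strict Implicit.
Unset Printing Implicit Defensive.

Import GRing.Theory.
Local Open Scope ring_scope.

Declare Scope tensor_scope.
Reserved Notation "a ⊗ b" (at level 40, left associativity).

(* Tensor product of finite-dimensional vector spaces, as the space of
   coordinate matrices relative to the bases vbasis fullv.  Its universal
   property is given by tlift_otimes and tensor_ext, and nothing outside the
   following section depends on the choice of this model. *)
Section Tensor.

Variable K : fieldType.

Definition tensor (A B : vectType K) : Type :=
  'M[K]_(\dim (fullv : {vspace A}), \dim (fullv : {vspace B})).

HB.instance Definition _ (A B : vectType K) := Vector.on (tensor A B).

Definition otimes (A B : vectType K) (a : A) (b : B) : tensor A B :=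
  \matrix_(i, j) (coord (vbasis fullv) i a * coord (vbasis fullv) j b).

Local Notation "a ⊗ b" := (otimes a b).

(* The linear map on A ⊗ B induced by a bilinear map beta on A x B; reading
   tlift (fun a1 a2 => E) (Delta a) as the Sweedler sum \sum E is legitimate
   as soon as E is bilinear in a1 and a2. *)
Definition tlift (A B V : vectType K) (beta : A -> B -> V) (t : tensor A B) : V :=
  \sum_i \sum_j t i j *: beta (vbasis fullv)`_i (vbasis fullv)`_j.

Definition bilin (A B V : vectType K) (beta : A -> B -> V) : Prop :=
  (forall b, linear (beta^~ b)) /\ (forall a, linear (beta a)).

Lemma tlift_is_linear (A B V : vectType K) (beta : A -> B -> V) :
  linear (tlift beta).
Proof.
move=> k t u; rewrite /tlift scaler_sumr -big_split; apply: eq_bigr => i _ /=.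
rewrite scaler_sumr -big_split; apply: eq_bigr => j _ /=.
by rewrite !mxE scalerDl scalerA.
Qed.

HB.instance Definition _ (A B V : vectType K) (beta : A -> B -> V) :=
  GRing.isLinear.Build K (tensor A B) V _ (tlift beta) (tlift_is_linear beta).

Lemma otimes_bilin (A B : vectType K) : bilin (@otimes A B).
Proof.
split=> [b k x y|a k x y]; apply/matrixP=> i j; rewrite !mxE linearP /=.
  by rewrite mulrDl mulrA.
by rewrite mulrDr mulrCA.
Qed.

Lemma otimesPl (A B : vectType K) k (x y : A) (b : B) :
  (k *: x + y) ⊗ b = k *: (x ⊗ b) + y ⊗ b.
Proof. exact: (otimes_bilin A B).1. Qed.

Lemma otimesPr (A B : vectType K) k (a : A) (x y : B) :
  a ⊗ (k *: x + y) = k *: (a ⊗ x) + a ⊗ y.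
Proof. exact: (otimes_bilin A B).2. Qed.

HB.instance Definition _ (A B : vectType K) (a : A) :=
  GRing.isLinear.Build K B (tensor A B) _ (otimes a) ((otimes_bilin A B).2 a).

Lemma otimes0l (A B : vectType K) (b : B) : (0 : A) ⊗ b = 0.
Proof. by apply/matrixP=> i j; rewrite !mxE linear0 mul0r. Qed.

Lemma tlift_lin (A B V : vectType K) (beta beta1 beta2 : A -> B -> V) k t :
  (forall a b, beta a b = k *: beta1 a b + beta2 a b) ->
  tlift beta t = k *: tlift beta1 t + tlift beta2 t.
Proof.
move=> e; rewrite scaler_sumr -big_split; apply: eq_bigr => i _ /=.
rewrite scaler_sumr -big_split; apply: eq_bigr => j _ /=.
by rewrite e scalerDr !scalerA mulrC.
Qed.

Lemma bilin_suml (A B V : vectType K) (beta : A -> B -> V) (I : finType)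
    (c : I -> K) (v : I -> A) b : bilin beta ->
  beta (\sum_i c i *: v i) b = \sum_i c i *: beta (v i) b.
Proof.
case=> /(_ b) lb _.
pose f : {linear A -> V} := HB.pack (beta^~ b) (GRing.isLinear.Build K A V _ _ lb).
by rewrite -[LHS]/(f _) linear_sum; apply: eq_bigr => i _; rewrite linearZ.
Qed.

Lemma bilin_sumr (A B V : vectType K) (beta : A -> B -> V) (I : finType)
    (c : I -> K) (v : I -> B) a : bilin beta ->
  beta a (\sum_i c i *: v i) = \sum_i c i *: beta a (v i).
Proof.
case=> _ /(_ a) lb.
pose f : {linear B -> V} := HB.pack (beta a) (GRing.isLinear.Build K B V _ _ lb).
by rewrite -[LHS]/(f _) linear_sum; apply: eq_bigr => i _; rewrite linearZ.
Qed.

Lemma bilin_suml1 (A B V : vectType K) (beta : A -> B -> V) (I : finType)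
    (v : I -> A) b : bilin beta ->
  beta (\sum_i v i) b = \sum_i beta (v i) b.
Proof.
move=> bb; rewrite (eq_bigr (fun i => 1 *: v i)) => [|i _]; last by rewrite scale1r.
by rewrite (bilin_suml _ _ _ bb); apply: eq_bigr => i _; rewrite scale1r.
Qed.

Lemma bilin_sumr1 (A B V : vectType K) (beta : A -> B -> V) (I : finType)
    (v : I -> B) a : bilin beta ->
  beta a (\sum_i v i) = \sum_i beta a (v i).
Proof.
move=> bb; rewrite (eq_bigr (fun i => 1 *: v i)) => [|i _]; last by rewrite scale1r.
by rewrite (bilin_sumr _ _ _ bb); apply: eq_bigr => i _; rewrite scale1r.
Qed.

Lemma tlift_otimes (A B V : vectType K) (beta : A -> B -> V) a b :
  bilin beta -> tlift beta (a ⊗ b) = beta a b.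
Proof.
move=> bb; rewrite [in RHS](coord_vbasis (memvf a)) bilin_suml //.
apply: eq_bigr => i _; rewrite [in RHS](coord_vbasis (memvf b)) bilin_sumr //.
rewrite scaler_sumr; apply: eq_bigr => j _.
by rewrite mxE scalerA.
Qed.

Lemma tensor_ext (A B V : vectType K) (f g : {linear tensor A B -> V}) :
  (forall a b, f (a ⊗ b) = g (a ⊗ b)) -> f =1 g.
Proof.
move=> fg t.
suff -> : t = \sum_i \sum_j t i j *: ((vbasis fullv)`_i ⊗ (vbasis fullv)`_j).
  rewrite !linear_sum; apply: eq_bigr => i _; rewrite !linear_sum.
  by apply: eq_bigr => j _; rewrite !linearZ fg.
have cE (E : vectType K) (x y : 'I_(\dim (fullv : {vspace E}))) :
    coord (vbasis fullv) x (vbasis fullv)`_y = (x == y)%:R.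
  by rewrite coord_free 1?eq_sym //; apply: basis_free (vbasisP _).
apply/matrixP=> k l; rewrite summxE (bigD1 k) //= summxE (bigD1 l) //= !mxE.
rewrite !cE !eqxx !mulr1 big1 => [|j /negPf jl]; last first.
  by rewrite !mxE !cE [l == j]eq_sym jl !mulr0.
rewrite addr0 big1 ?addr0 // => i /negPf ik; rewrite summxE big1 // => j _.
by rewrite !mxE !cE [k == i]eq_sym ik mul0r mulr0.
Qed.

Definition tmap (A B C D : vectType K) (f : A -> C) (g : B -> D) :
  tensor A B -> tensor C D := tlift (fun a b => f a ⊗ g b).

HB.instance Definition _ (A B C D : vectType K) (f : A -> C) (g : B -> D) :=
  GRing.Linear.on (tmap f g).

Definition tmul (A B : falgType K) (t u : tensor A B) : tensor A B :=
  tlift (fun a b => tlift (fun c d => (a * c) ⊗ (b * d)) u) t.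

Lemma mul_bilin (A : falgType K) : bilin ( *%R : A -> A -> A).
Proof.
by split=> [b k x y|a k x y]; [rewrite mulrDl scalerAl | rewrite mulrDr scalerAr].
Qed.

Lemma tmul_bilin (A B : falgType K) : bilin (@tmul A B).
Proof.
split=> [u|t k x y]; first exact: linearP.
by apply: tlift_lin => a b; apply: linearP.
Qed.

Lemma tmul_otimes (A B : falgType K) (a c : A) (b d : B) :
  tmul (a ⊗ b) (c ⊗ d) = (a * c) ⊗ (b * d).
Proof.
have [lA rA] := mul_bilin A; have [lB rB] := mul_bilin B.
rewrite /tmul tlift_otimes ?tlift_otimes //.
  by split=> [y k x x'|x k y y'] /=; rewrite (rA, rB) (otimesPl, otimesPr).
split=> [y k x x'|x k y y'] /=; apply: tlift_lin => z w.
  by rewrite lA otimesPl.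
by rewrite lB otimesPr.
Qed.

Lemma bilin_comp (A B C D V : vectType K) (beta : C -> D -> V)
    (f : {linear A -> C}) (g : {linear B -> D}) :
  bilin beta -> bilin (fun a b => beta (f a) (g b)).
Proof.
by case=> l r; split=> [b k x y|a k x y] /=; rewrite linearP; [apply: l | apply: r].
Qed.

Lemma bilin_scalel (A V : vectType K) (f : {scalar A}) :
  bilin (fun (a : A) (v : V) => f a *: v).
Proof.
split=> [b k x y|a k x y] /=; first by rewrite linearP scalerDl scalerA.
by rewrite scalerDr !scalerA mulrC.
Qed.

Lemma bilin_scaler (A V : vectType K) (f : {scalar A}) :
  bilin (fun (v : V) (a : A) => f a *: v).
Proof. by have [l r] := bilin_scalel V f; split. Qed.

Definition scalarA (A : falgType K) (f : {scalar A}) (a : A) : A := (f a)%:A.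

Lemma scalarA_is_linear (A : falgType K) (f : {scalar A}) : linear (scalarA f).
Proof. by move=> k x y; rewrite /scalarA linearP scalerDl scalerA. Qed.

HB.instance Definition _ (A : falgType K) (f : {scalar A}) :=
  GRing.isLinear.Build K A A _ (scalarA f) (scalarA_is_linear f).

Lemma bilin_otimes3 (A : vectType K) (c : A) :
  bilin (fun a b : A => a ⊗ (b ⊗ c)).
Proof.
by split=> [b k x y|a k x y] /=; rewrite !otimesPl ?otimesPr.
Qed.

Lemma bilin_assoc (A : vectType K) (D : {linear A -> tensor A A}) :
  bilin (fun a1 a2 : A => tlift (fun b1 b2 : A => b1 ⊗ (b2 ⊗ a2)) (D a1)).
Proof.
split=> [b k x y|a k x y] /=; first by rewrite !linearP.
by apply: tlift_lin => z w; rewrite !otimesPr.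
Qed.

End Tensor.

Notation "a ⊗ b" := (otimes a b) : tensor_scope.
Local Open Scope tensor_scope.

HB.mixin Record Vector_isCoalgebra (K : fieldType) A of Vector K A := {
  comul : {linear A -> tensor A A};
  counit : {scalar A};
  comulA : forall a : A,
    tlift (fun a1 a2 => a1 ⊗ comul a2) (comul a) =
    tlift (fun a1 a2 => tlift (fun b1 b2 => b1 ⊗ (b2 ⊗ a2)) (comul a1)) (comul a);
  counitl : forall a : A, tlift (fun a1 a2 => counit a1 *: a2) (comul a) = a;
  counitr : forall a : A, tlift (fun a1 a2 => counit a2 *: a1) (comul a) = a;
}.

#[short(type="coalgType")]
HB.structure Definition Coalgebra (K : fieldType) :=
  { A of Vector K A & Vector_isCoalgebra K A }.

HB.mixin Record Coalgebra_isBialgebra (K : fieldType) A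
    of Coalgebra K A & Falgebra K A := {
  comul1 : comul (1 : A) = (1 : A) ⊗ (1 : A);
  comulM : forall a b : A, comul (a * b) = tmul (comul a) (comul b);
  counit1 : counit (1 : A) = 1;
  counitM : forall a b : A, counit (a * b) = counit a * counit b;
}.

(* Finite-dimensional, since falgType is. *)
#[short(type="bialgType")]
HB.structure Definition Bialgebra (K : fieldType) :=
  { A of Coalgebra K A & Falgebra K A & Coalgebra_isBialgebra K A }.

HB.mixin Record Bialgebra_isHopf (K : fieldType) A of Bialgebra K A := {
  antipode : {linear A -> A};
  antipodel : forall a : A,
    tlift (fun a1 a2 => antipode a1 * a2) (comul a) = (counit a)%:A;
  antipoder : forall a : A,
    tlift (fun a1 a2 => a1 * antipode a2) (comul a) = (counit a)%:A;
}.

#[short(type="hopfType")]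
HB.structure Definition Hopf (K : fieldType) :=
  { A of Bialgebra K A & Bialgebra_isHopf K A }.

(* A vector space A together with a linear endomorphism of A ⊗ A *)
Record lpair (K : fieldType) := LPair {
  lcar : vectType K;
  lPhi : {linear tensor lcar lcar -> tensor lcar lcar}
}.

Definition lpair_iso (K : fieldType) (X Y : lpair K) : Prop :=
  exists f : {linear lcar X -> lcar Y},
    bijective f /\ tmap f f \o lPhi X =1 lPhi Y \o tmap f f.

(* Phi (a ⊗ b) = \sum a1 b ⊗ a2 *)
Definition lEAS_map (K : fieldType) (A : bialgType K) :
    tensor A A -> tensor A A :=
  tlift (fun a b : A => tlift (fun a1 a2 : A => (a1 * b) ⊗ a2) (comul a)).

HB.instance Definition _ (K : fieldType) (A : bialgType K) :=
  GRing.Linear.on (@lEAS_map K A).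

Lemma lEAS_otimes (K : fieldType) (A : bialgType K) (a b : A) :
  lEAS_map (a ⊗ b) = tlift (fun a1 a2 : A => (a1 * b) ⊗ a2) (comul a).
Proof.
rewrite /lEAS_map tlift_otimes //.
split=> [y k x x'|x k y y'] /=; first by rewrite !linearP.
by apply: tlift_lin => z w; rewrite mulrDr -scalerAr otimesPl.
Qed.

Definition lEAS (K : fieldType) (A : bialgType K) : lpair K :=
  LPair (@lEAS_map K A).

(* Phi (a ⊗ b) = \sum b1 ⊗ S(b2) a *)
Definition lEAS'_map (K : fieldType) (A : hopfType K) :
    tensor A A -> tensor A A :=
  tlift (fun a b : A => tlift (fun b1 b2 : A => b1 ⊗ (antipode b2 * a)) (comul b)).

HB.instance Definition _ (K : fieldType) (A : hopfType K) :=
  GRing.Linear.on (@lEAS'_map K A).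

Lemma lEAS'_otimes (K : fieldType) (A : hopfType K) (a b : A) :
  lEAS'_map (a ⊗ b) = tlift (fun b1 b2 : A => b1 ⊗ (antipode b2 * a)) (comul b).
Proof.
rewrite /lEAS'_map tlift_otimes //.
split=> [y k x x'|x k y y'] /=; last by rewrite !linearP.
by apply: tlift_lin => z w; rewrite mulrDr -scalerAr otimesPr.
Qed.

Definition lEAS' (K : fieldType) (A : hopfType K) : lpair K :=
  LPair (@lEAS'_map K A).

Section FiniteGroup.

Variables (K : fieldType) (G : finGroupType).

Local Notation KG := {ffun G -> K^o}.

Definition fbasis (g : G) : KG := [ffun h => (h == g)%:R].

Lemma fbasis_sum (x : KG) : x = \sum_g x g *: fbasis g.
Proof.
apply/ffunP=> h; rewrite sum_ffunE (bigD1 h) //= !ffunE eqxx [_ *: _]mulr1.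
rewrite big1 ?addr0 // => g /negPf gh; rewrite !ffunE eq_sym gh.
exact: mulr0.
Qed.

Lemma fbasis_ext (V : vectType K) (f f' : {linear KG -> V}) :
  (forall g, f (fbasis g) = f' (fbasis g)) -> f =1 f'.
Proof.
move=> e x; rewrite (fbasis_sum x) !linear_sum; apply: eq_bigr => g _.
by rewrite !linearZ e.
Qed.

Lemma fbasis_ext2 (V : vectType K) (f f' : KG -> KG -> V) :
    bilin f -> bilin f' ->
  (forall g h, f (fbasis g) (fbasis h) = f' (fbasis g) (fbasis h)) -> f =2 f'.
Proof.
move=> bf bf' e x y; rewrite (fbasis_sum x) (bilin_suml _ _ _ bf) (bilin_suml _ _ _ bf'); apply: eq_bigr => g _.
congr (_ *: _); rewrite (fbasis_sum y) (bilin_sumr _ _ _ bf) (bilin_sumr _ _ _ bf').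
by apply: eq_bigr => h _; rewrite e.
Qed.

Definition flin (V : vectType K) (v : G -> V) (x : KG) : V :=
  \sum_g x g *: v g.

Lemma flin_is_linear (V : vectType K) (v : G -> V) : linear (flin v).
Proof.
move=> k x y; rewrite /flin scaler_sumr -big_split; apply: eq_bigr => g _ /=.
by rewrite !ffunE scalerDl scalerA.
Qed.

HB.instance Definition _ (V : vectType K) (v : G -> V) :=
  GRing.isLinear.Build K KG V _ (flin v) (flin_is_linear v).

Lemma flin_fbasis (V : vectType K) (v : G -> V) g : flin v (fbasis g) = v g.
Proof.
rewrite /flin (bigD1 g) //= ffunE eqxx scale1r big1 ?addr0 // => h /negPf hg.
by rewrite ffunE hg scale0r.
Qed.

Definition groupAlg : Type := KG.
HB.instance Definition _ := Vector.on groupAlg.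

Definition gelt (g : G) : groupAlg := fbasis g.

Definition gmul (x y : groupAlg) : groupAlg :=
  flin (fun g => flin (fun h => gelt (g * h)%g) y) x.

Lemma gmul_bilin : bilin gmul.
Proof.
split=> [y|x k y y']; first exact: linearP.
rewrite /gmul /flin [in RHS]scaler_sumr -big_split; apply: eq_bigr => g _ /=.
rewrite -!/(flin _ _) linearP scalerDr.
by rewrite scalerA [x g * k]mulrC -scalerA.
Qed.

Lemma gmul_gelt g h : gmul (gelt g) (gelt h) = gelt (g * h)%g.
Proof. by rewrite /gmul !flin_fbasis. Qed.

Lemma gmul1l : left_id (gelt 1%g) gmul.
Proof.
move=> x; rewrite {1}(fbasis_sum x) (bilin_sumr _ _ _ gmul_bilin) [in RHS](fbasis_sum x).
by apply: eq_bigr => g _; rewrite gmul_gelt mul1g.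
Qed.

Lemma gmul1r : right_id (gelt 1%g) gmul.
Proof.
move=> x; rewrite {1}(fbasis_sum x) (bilin_suml _ _ _ gmul_bilin) [in RHS](fbasis_sum x).
by apply: eq_bigr => g _; rewrite gmul_gelt mulg1.
Qed.

Lemma gmulDl : left_distributive gmul +%R.
Proof. by move=> x y z; have := gmul_bilin.1 z 1 x y; rewrite !scale1r. Qed.

Lemma gmulDr : right_distributive gmul +%R.
Proof. by move=> x y z; have := gmul_bilin.2 x 1 y z; rewrite !scale1r. Qed.

Lemma gmulA : associative gmul.
Proof.
have lg k x y z : gmul (k *: x + y) z = k *: gmul x z + gmul y z.
  exact: gmul_bilin.1.
have rg k x y z : gmul z (k *: x + y) = k *: gmul z x + gmul z y.
  exact: gmul_bilin.2.
move=> x y z; move: y z; apply: fbasis_ext2 => [||g h].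
- by split=> [b k y y'|a k y y'] /=; [rewrite lg rg | rewrite !rg].
- by split=> [b k y y'|a k y y'] /=; [rewrite rg lg | rewrite rg].
have gl c b : gmul (\sum_i c i *: gelt i) b = \sum_i c i *: gmul (gelt i) b.
  exact: bilin_suml gmul_bilin.
rewrite gmul_gelt (fbasis_sum x) !gl (bilin_suml _ _ _ gmul_bilin).
by apply: eq_bigr => f _; rewrite !gmul_gelt mulgA.
Qed.

Lemma gelt1_neq0 : gelt 1%g != 0.
Proof. by apply/eqP=> /ffunP/(_ 1%g)/eqP; rewrite !ffunE eqxx oner_eq0. Qed.

HB.instance Definition _ := GRing.Zmodule_isNzRing.Build groupAlg
  gmulA gmul1l gmul1r gmulDl gmulDr gelt1_neq0.

Lemma gmul_scalel (k : K) (x y : groupAlg) : k *: (x * y) = (k *: x) * y.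
Proof.
have z : gmul 0 y = 0 := mul0r y.
by have := gmul_bilin.1 y k x 0; rewrite /= z !addr0 => <-.
Qed.

HB.instance Definition _ := GRing.Lmodule_isLalgebra.Build K groupAlg gmul_scalel.

Lemma gmul_scaler (k : K) (x y : groupAlg) : k *: (x * y) = x * (k *: y).
Proof.
have z : gmul x 0 = 0 := mulr0 x.
by have := gmul_bilin.2 x k y 0; rewrite z !addr0 => <-.
Qed.

HB.instance Definition _ := GRing.Lalgebra_isAlgebra.Build K groupAlg gmul_scaler.
HB.instance Definition _ := Algebra_isFalgebra.Build K groupAlg.

Lemma geltM g h : gelt g * gelt h = gelt (g * h)%g.
Proof. exact: gmul_gelt. Qed.

Definition gcomul : groupAlg -> tensor groupAlg groupAlg :=
  flin (fun g => gelt g ⊗ gelt g).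
HB.instance Definition _ :=
  GRing.isLinear.Build K groupAlg _ _ gcomul (flin_is_linear _).

Definition gcounit (x : groupAlg) : K := \sum_g x g.
Lemma gcounit_is_scalar : scalar gcounit.
Proof.
move=> k x y; rewrite /gcounit mulr_sumr -big_split; apply: eq_bigr => g _.
by rewrite !ffunE.
Qed.
HB.instance Definition _ :=
  GRing.isLinear.Build K groupAlg K _ gcounit gcounit_is_scalar.

Definition gantipode : groupAlg -> groupAlg := flin (fun g => gelt g^-1%g).
HB.instance Definition _ :=
  GRing.isLinear.Build K groupAlg _ _ gantipode (flin_is_linear _).

Lemma gcomul_gelt g : gcomul (gelt g) = gelt g ⊗ gelt g.
Proof. exact: flin_fbasis. Qed.

Lemma gcounit_gelt g : gcounit (gelt g) = 1.
Proof.
rewrite /gcounit (bigD1 g) //= ffunE eqxx big1 ?addr0 // => h /negPf hg.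
by rewrite ffunE hg.
Qed.

Lemma gantipode_gelt g : gantipode (gelt g) = gelt g^-1%g.
Proof. exact: flin_fbasis. Qed.

Lemma gelt_ext (V : vectType K) (f f' : {linear groupAlg -> V}) :
  (forall g, f (gelt g) = f' (gelt g)) -> f =1 f'.
Proof.
move=> e x; rewrite (fbasis_sum x) !linear_sum; apply: eq_bigr => g _.
by rewrite !linearZ e.
Qed.

Lemma gcomulA (a : groupAlg) :
  tlift (fun a1 a2 : groupAlg => a1 ⊗ gcomul a2) (gcomul a) =
  tlift (fun a1 a2 => tlift (fun b1 b2 => b1 ⊗ (b2 ⊗ a2)) (gcomul a1)) (gcomul a).
Proof.
move: a; apply: (gelt_ext (f := tlift _ \o gcomul) (f' := tlift _ \o gcomul)).
move=> g /=; rewrite gcomul_gelt.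
rewrite !tlift_otimes ?gcomul_gelt ?tlift_otimes //.
- exact: bilin_otimes3.
- exact: bilin_assoc.
- exact: (bilin_comp idfun gcomul (otimes_bilin _ _)).
Qed.

Lemma gcounitl (a : groupAlg) :
  tlift (fun a1 a2 : groupAlg => gcounit a1 *: a2) (gcomul a) = a.
Proof.
move: a; apply: (gelt_ext (f := tlift _ \o gcomul) (f' := idfun)) => g /=.
by rewrite gcomul_gelt tlift_otimes ?gcounit_gelt ?scale1r //; apply: bilin_scalel.
Qed.

Lemma gcounitr (a : groupAlg) :
  tlift (fun a1 a2 : groupAlg => gcounit a2 *: a1) (gcomul a) = a.
Proof.
move: a; apply: (gelt_ext (f := tlift _ \o gcomul) (f' := idfun)) => g /=.
by rewrite gcomul_gelt tlift_otimes ?gcounit_gelt ?scale1r //; apply: bilin_scaler.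
Qed.

HB.instance Definition _ :=
  Vector_isCoalgebra.Build K groupAlg gcomulA gcounitl gcounitr.

Lemma gcomul1 : gcomul 1 = (1 : groupAlg) ⊗ (1 : groupAlg).
Proof. exact: gcomul_gelt. Qed.

Lemma gcomulM (a b : groupAlg) : gcomul (a * b) = tmul (gcomul a) (gcomul b).
Proof.
move: a b; apply: (fbasis_ext2 (f := fun a b => gcomul (gmul a b))
  (f' := fun a b => tmul (gcomul a) (gcomul b))) => [||g h].
- by split=> [b k x y|a k x y];
    [rewrite (gmul_bilin.1 b) | rewrite (gmul_bilin.2 a)]; rewrite linearP.
- exact: (bilin_comp gcomul gcomul (tmul_bilin _ _)).
by rewrite gmul_gelt !gcomul_gelt tmul_otimes geltM.
Qed.

Lemma gcounit1 : gcounit 1 = 1.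
Proof. exact: gcounit_gelt. Qed.

Lemma gcounitM (a b : groupAlg) : gcounit (a * b) = gcounit a * gcounit b.
Proof.
move: a b; apply: (fbasis_ext2 (V := K^o) (f := fun a b => gcounit (gmul a b))
  (f' := fun a b => gcounit a * gcounit b)) => [||g h].
- by split=> [b k x y|a k x y];
    [rewrite (gmul_bilin.1 b) | rewrite (gmul_bilin.2 a)]; rewrite linearP.
- by split=> [b k x y|a k x y] /=; rewrite linearP;
    [rewrite mulrDl -mulrA | rewrite mulrDr mulrCA].
by rewrite gmul_gelt !gcounit_gelt mulr1.
Qed.

HB.instance Definition _ :=
  Coalgebra_isBialgebra.Build K groupAlg gcomul1 gcomulM gcounit1 gcounitM.

Lemma gantipodel (a : groupAlg) :
  tlift (fun a1 a2 : groupAlg => gantipode a1 * a2) (gcomul a) = (gcounit a)%:A.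
Proof.
move: a; apply: (gelt_ext (f := tlift _ \o gcomul)
  (f' := scalarA gcounit)) => g /=.
rewrite /scalarA /= gcomul_gelt tlift_otimes ?gantipode_gelt ?gcounit_gelt ?scale1r.
  by rewrite geltM mulVg.
exact: (bilin_comp gantipode idfun (mul_bilin _)).
Qed.

Lemma gantipoder (a : groupAlg) :
  tlift (fun a1 a2 : groupAlg => a1 * gantipode a2) (gcomul a) = (gcounit a)%:A.
Proof.
move: a; apply: (gelt_ext (f := tlift _ \o gcomul)
  (f' := scalarA gcounit)) => g /=.
rewrite /scalarA /= gcomul_gelt tlift_otimes ?gantipode_gelt ?gcounit_gelt ?scale1r.
  by rewrite geltM mulgV.
exact: (bilin_comp idfun gantipode (mul_bilin _)).
Qed.

HB.instance Definition _ :=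
  Bialgebra_isHopf.Build K groupAlg gantipodel gantipoder.

(* The function algebra K^G: the product is the pointwise product inherited
   from the ring structure of {ffun G -> K^o}. *)
Definition funAlg : Type := KG.
HB.instance Definition _ := Vector.on funAlg.
HB.instance Definition _ := GRing.PzRing.on funAlg.

Definition delta (g : G) : funAlg := fbasis g.

Lemma funAlg1_neq0 : (1 : funAlg) != 0.
Proof. by apply/eqP=> /ffunP/(_ 1%g)/eqP; rewrite !ffunE oner_eq0. Qed.

HB.instance Definition _ := GRing.PzSemiRing_isNonZero.Build funAlg funAlg1_neq0.

Lemma funAlg_scalel (k : K) (x y : funAlg) : k *: (x * y) = (k *: x) * y.
Proof. by apply/ffunP=> g; rewrite !ffunE -scalerAl. Qed.

HB.instance Definition _ := GRing.Lmodule_isLalgebra.Build K funAlg funAlg_scalel.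

Lemma funAlg_scaler (k : K) (x y : funAlg) : k *: (x * y) = x * (k *: y).
Proof. by apply/ffunP=> g; rewrite !ffunE -scalerAr. Qed.

HB.instance Definition _ := GRing.Lalgebra_isAlgebra.Build K funAlg funAlg_scaler.
HB.instance Definition _ := Algebra_isFalgebra.Build K funAlg.

Lemma delta_ext (V : vectType K) (f f' : {linear funAlg -> V}) :
  (forall g, f (delta g) = f' (delta g)) -> f =1 f'.
Proof.
move=> e x; rewrite (fbasis_sum x) !linear_sum; apply: eq_bigr => g _.
by rewrite !linearZ e.
Qed.

Lemma deltaM g h : delta g * delta h = (g == h)%:R *: delta g.
Proof.
apply/ffunP=> k; rewrite !ffunE; case: (k =P g) => [->|_].
  by rewrite [LHS]mul1r [RHS]mulr1.
by rewrite [LHS]mul0r [RHS]mulr0.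
Qed.

Lemma delta_sum1 : \sum_g delta g = 1.
Proof.
apply/ffunP=> h; rewrite sum_ffunE !ffunE (bigD1 h) //= ffunE eqxx big1 ?addr0 //.
by move=> g /negPf gh; rewrite ffunE eq_sym gh.
Qed.

Definition fcomul : funAlg -> tensor funAlg funAlg :=
  flin (fun g => \sum_(p : G * G | (p.1 * p.2)%g == g) delta p.1 ⊗ delta p.2).
HB.instance Definition _ :=
  GRing.isLinear.Build K funAlg _ _ fcomul (flin_is_linear _).

Definition fcounit (x : funAlg) : K := x 1%g.
Lemma fcounit_is_scalar : scalar fcounit.
Proof. by move=> k x y; rewrite /fcounit !ffunE. Qed.
HB.instance Definition _ :=
  GRing.isLinear.Build K funAlg K _ fcounit fcounit_is_scalar.

Definition fantipode : funAlg -> funAlg := flin (fun g => delta g^-1%g).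
HB.instance Definition _ :=
  GRing.isLinear.Build K funAlg _ _ fantipode (flin_is_linear _).

Lemma fcomul_delta g :
  fcomul (delta g) = \sum_h delta h ⊗ delta (h^-1 * g)%g.
Proof.
rewrite [LHS]flin_fbasis; rewrite (reindex (fun h => (h, (h^-1 * g)%g))) /=.
  by apply: eq_bigl => h; rewrite mulKVg eqxx.
by exists fst => [h|[h k] /eqP/= <-]; rewrite //= mulKg.
Qed.

Lemma fcounit_delta g : fcounit (delta g) = (g == 1%g)%:R.
Proof. by rewrite /fcounit ffunE eq_sym. Qed.

Lemma fantipode_delta g : fantipode (delta g) = delta g^-1%g.
Proof. exact: flin_fbasis. Qed.

Lemma fcomulA (a : funAlg) :
  tlift (fun a1 a2 : funAlg => a1 ⊗ fcomul a2) (fcomul a) =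
  tlift (fun a1 a2 => tlift (fun b1 b2 => b1 ⊗ (b2 ⊗ a2)) (fcomul a1)) (fcomul a).
Proof.
move: a; apply: (delta_ext (f := tlift _ \o fcomul) (f' := tlift _ \o fcomul)).
move=> g /=; rewrite fcomul_delta !linear_sum /=.
have L h : tlift (fun a1 a2 => a1 ⊗ fcomul a2) (delta h ⊗ delta (h^-1 * g)%g) =
    \sum_k delta h ⊗ (delta k ⊗ delta (k^-1 * (h^-1 * g))%g).
  rewrite tlift_otimes; last exact: (bilin_comp idfun fcomul (otimes_bilin _ _)).
  by rewrite fcomul_delta linear_sum.
have R h : tlift (fun a1 a2 : funAlg =>
      tlift (fun b1 b2 : funAlg => b1 ⊗ (b2 ⊗ a2)) (fcomul a1))
      (delta h ⊗ delta (h^-1 * g)%g) =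
    \sum_k delta k ⊗ (delta (k^-1 * h)%g ⊗ delta (h^-1 * g)%g).
  rewrite tlift_otimes; last exact: bilin_assoc.
  rewrite fcomul_delta linear_sum; apply: eq_bigr => k _ /=.
  by rewrite tlift_otimes //; apply: bilin_otimes3.
rewrite (eq_bigr _ (fun h _ => L h)) (eq_bigr _ (fun h _ => R h)).
rewrite [RHS]exchange_big; apply: eq_bigr => h _ /=.
rewrite [RHS](reindex_inj (mulgI h)); apply: eq_bigr => k _ /=.
by rewrite mulKg invMg mulgA.
Qed.

Lemma fcounitl (a : funAlg) :
  tlift (fun a1 a2 : funAlg => fcounit a1 *: a2) (fcomul a) = a.
Proof.
move: a; apply: (delta_ext (f := tlift _ \o fcomul) (f' := idfun)) => g /=.
rewrite fcomul_delta linear_sum (bigD1 1%g) //=.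
rewrite tlift_otimes; last exact: bilin_scalel.
rewrite fcounit_delta eqxx scale1r invg1 mul1g big1 ?addr0 // => h /negPf h1.
rewrite tlift_otimes; last exact: bilin_scalel.
by rewrite fcounit_delta h1 scale0r.
Qed.

Lemma fcounitr (a : funAlg) :
  tlift (fun a1 a2 : funAlg => fcounit a2 *: a1) (fcomul a) = a.
Proof.
move: a; apply: (delta_ext (f := tlift _ \o fcomul) (f' := idfun)) => g /=.
rewrite fcomul_delta linear_sum (bigD1 g) //=.
rewrite tlift_otimes; last exact: bilin_scaler.
rewrite fcounit_delta mulVg eqxx scale1r big1 ?addr0 // => h /negPf hg.
rewrite tlift_otimes; last exact: bilin_scaler.
by rewrite fcounit_delta -eq_mulVg1 hg scale0r.
Qed.

HB.instance Definition _ :=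
  Vector_isCoalgebra.Build K funAlg fcomulA fcounitl fcounitr.

Lemma fcomul1 : fcomul 1 = (1 : funAlg) ⊗ (1 : funAlg).
Proof.
rewrite -delta_sum1 linear_sum (bilin_suml1 _ _ (otimes_bilin _ _)).
rewrite (eq_bigr _ (fun g _ => fcomul_delta g)) exchange_big.
apply: eq_bigr => h _; rewrite linear_sum [LHS](reindex_inj (mulgI h)).
by apply: eq_bigr => g _; rewrite /= mulKg.
Qed.

Lemma fcomulM (a b : funAlg) : fcomul (a * b) = tmul (fcomul a) (fcomul b).
Proof.
move: a b; apply: (fbasis_ext2 (f := fun a b : funAlg => fcomul (a * b))
  (f' := fun a b => tmul (fcomul a) (fcomul b))) => [||g h].
- have [lA rA] := mul_bilin (funAlg : falgType K).
  by split=> [b k x y|a k x y]; [rewrite (lA b) | rewrite (rA a)]; rewrite linearP.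
- exact: (bilin_comp fcomul fcomul (tmul_bilin _ _)).
rewrite -!/(delta _) deltaM linearZ /= !fcomul_delta.
rewrite (bilin_suml1 _ _ (tmul_bilin _ _)) scaler_sumr; apply: eq_bigr => a _.
rewrite (bilin_sumr1 _ _ (tmul_bilin _ _)) (bigD1 a) //= tmul_otimes !deltaM.
rewrite eqxx scale1r (inj_eq (mulgI _)) linearZ /= big1 ?addr0 // => b /negPf ba.
by rewrite tmul_otimes deltaM eq_sym ba scale0r otimes0l.
Qed.

Lemma fcounit1 : fcounit 1 = 1.
Proof. by rewrite /fcounit ffunE. Qed.

Lemma fcounitM (a b : funAlg) : fcounit (a * b) = fcounit a * fcounit b.
Proof. by rewrite /fcounit ffunE. Qed.

HB.instance Definition _ :=
  Coalgebra_isBialgebra.Build K funAlg fcomul1 fcomulM fcounit1 fcounitM.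

Lemma fantipodel (a : funAlg) :
  tlift (fun a1 a2 : funAlg => fantipode a1 * a2) (fcomul a) = (fcounit a)%:A.
Proof.
move: a; apply: (delta_ext (f := tlift _ \o fcomul)
  (f' := scalarA fcounit)) => g /=.
rewrite /scalarA /= fcomul_delta linear_sum fcounit_delta -delta_sum1 scaler_sumr.
rewrite [RHS](reindex_inj invg_inj); apply: eq_bigr => h _ /=.
rewrite tlift_otimes; last exact: (bilin_comp fantipode idfun (mul_bilin _)).
by rewrite fantipode_delta deltaM eq_sym -[X in _ == X]mulg1 (inj_eq (mulgI _)).
Qed.

Lemma fantipoder (a : funAlg) :
  tlift (fun a1 a2 : funAlg => a1 * fantipode a2) (fcomul a) = (fcounit a)%:A.
Proof.
move: a; apply: (delta_ext (f := tlift _ \o fcomul)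
  (f' := scalarA fcounit)) => g /=.
rewrite /scalarA /= fcomul_delta linear_sum fcounit_delta -delta_sum1 scaler_sumr.
apply: eq_bigr => h _ /=.
rewrite tlift_otimes; last exact: (bilin_comp idfun fantipode (mul_bilin _)).
rewrite fantipode_delta deltaM invMg invgK -[X in X == _]mul1g (inj_eq (mulIg _)).
by rewrite eq_sym -{1}[1%g]invg1 (inj_eq invg_inj).
Qed.

HB.instance Definition _ :=
  Bialgebra_isHopf.Build K funAlg fantipodel fantipoder.

End FiniteGroup.

Definition opg (G : Type) : Type := G.
HB.instance Definition _ (G : finGroupType) := Finite.on (opg G).
HB.instance Definition _ (G : finGroupType) := Finite_isGroup.Build (opg G)
  (mul := fun x y : opg G => (y * x : G)%g) (one := (1 : G)%g)
  (inv := fun x : opg G => (x^-1 : G)%g)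
  (fun x y z => esym (@mulgA G z y x)) (@mulg1 G) (@mulgV G).

(* Main.v *)
Require Import Defs.
From mathcomp Require Import all_boot all_algebra all_fingroup all_field.

(** Why the theorem holds.  In the canonical bases, each of the four maps
    permutes elementary tensors of basis vectors, so it is the linearization of
    a map G x G -> G x G:
    - on lEAS' (K G),    (g, h) |-> (h, h^-1 g), since h is group-like;
    - on lEAS (K^G),     (g, h) |-> (h, h^-1 g): in the coproduct of delta_g
      only the term whose left leg is delta_h survives multiplication by it;
    - on lEAS' (K^G),    (g, h) |-> (h g, g): in the coproduct of delta_h only
      the term whose right leg is delta_(g^-1) survives;
    - on lEAS (K G^op),  (g, h) |-> (h g, g), the product of g and h in the
      opposite group being h g.
    The first two maps of sets coincide, and so do the last two.  Hence both
    isomorphisms are the linear maps that match the canonical bases; the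
    reduction from pairs over K to maps of sets is lpair_iso_of_basis. *)

Set Implicit Arguments.
Unset Strict Implicit.
Unset Printing Implicit Defensive.

Import GRing.Theory.
Local Open Scope ring_scope.
Local Open Scope tensor_scope.

Section BasisTransport.

Variable K : fieldType.

Lemma tensor_fbasis_ext (G : finGroupType) (V : vectType K)
    (F F' : {linear tensor {ffun G -> K^o} {ffun G -> K^o} -> V}) :
  (forall g h, F (fbasis K g ⊗ fbasis K h) = F' (fbasis K g ⊗ fbasis K h)) ->
  F =1 F'.
Proof.
move=> e; apply: tensor_ext.
have bF (L : {linear tensor {ffun G -> K^o} {ffun G -> K^o} -> V}) :
    bilin (fun x y => L (x ⊗ y)).
  by split=> [b k x y|a k x y] /=; rewrite (otimesPl, otimesPr) linearP.
exact: fbasis_ext2 (bF F) (bF F') e.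
Qed.

Lemma tmap_otimes (A B C D : vectType K) (f : {linear A -> C})
    (g : {linear B -> D}) a b : tmap f g (a ⊗ b) = f a ⊗ g b.
Proof.
by rewrite /tmap tlift_otimes //; apply: (bilin_comp f g (otimes_bilin _ _)).
Qed.

(** The groups G and H serve as index sets of bases, and s is a bijection of
    sets: this covers the identity map from a group to its opposite. *)
Lemma lpair_iso_of_basis (G H : finGroupType) (s : G -> H) (p q : G -> G -> G)
    (Phi : {linear tensor {ffun G -> K^o} {ffun G -> K^o} ->
                   tensor {ffun G -> K^o} {ffun G -> K^o}})
    (Psi : {linear tensor {ffun H -> K^o} {ffun H -> K^o} ->
                   tensor {ffun H -> K^o} {ffun H -> K^o}}) :
    bijective s ->
    (forall g h, Phi (fbasis K g ⊗ fbasis K h) =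
                 fbasis K (p g h) ⊗ fbasis K (q g h)) ->
    (forall g h, Psi (fbasis K (s g) ⊗ fbasis K (s h)) =
                 fbasis K (s (p g h)) ⊗ fbasis K (s (q g h))) ->
  lpair_iso (LPair Phi) (LPair Psi).
Proof.
move=> [t st ts] PhiE PsiE.
pose f : {linear {ffun G -> K^o} -> {ffun H -> K^o}} :=
  flin (fun g => fbasis K (s g)).
pose f' : {linear {ffun H -> K^o} -> {ffun G -> K^o}} :=
  flin (fun h => fbasis K (t h)).
have fE g : f (fbasis K g) = fbasis K (s g) by apply: flin_fbasis.
have f'E h : f' (fbasis K h) = fbasis K (t h) by apply: flin_fbasis.
exists f; split.
  exists f'.
    by apply: (fbasis_ext (f := f' \o f) (f' := idfun)) => g; rewrite /= fE f'E st.
  by apply: (fbasis_ext (f := f \o f') (f' := idfun)) => h; rewrite /= f'E fE ts.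
apply: (tensor_fbasis_ext (F := tmap f f \o Phi) (F' := Psi \o tmap f f)) => g h.
by rewrite /= PhiE !tmap_otimes /= !fE PsiE.
Qed.

End BasisTransport.

Section BasisFormulas.

Variables (K : fieldType) (G : finGroupType).

Lemma lEAS'_gelt (g h : G) :
  lEAS'_map (gelt K g ⊗ gelt K h) = gelt K h ⊗ gelt K (h^-1 * g)%g.
Proof.
rewrite lEAS'_otimes [comul _]gcomul_gelt tlift_otimes.
  by rewrite [antipode _]gantipode_gelt geltM.
split=> [b k x y|a k x y] /=; first by rewrite otimesPl.
by rewrite linearP mulrDl -scalerAl otimesPr.
Qed.

Lemma lEAS_gelt (g h : G) :
  lEAS_map (gelt K g ⊗ gelt K h) = gelt K (g * h)%g ⊗ gelt K g.
Proof.
rewrite lEAS_otimes [comul _]gcomul_gelt tlift_otimes ?geltM //.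
split=> [b k x y|a k x y] /=; last by rewrite otimesPr.
by rewrite mulrDl -scalerAl otimesPl.
Qed.

Lemma lEAS_delta (g h : G) :
  lEAS_map (delta K g ⊗ delta K h) = delta K h ⊗ delta K (h^-1 * g)%g.
Proof.
have bl : bilin (fun a1 a2 : funAlg K G => (a1 * delta K h) ⊗ a2).
  split=> [b k x y|a k x y] /=; last by rewrite otimesPr.
  by rewrite mulrDl -scalerAl otimesPl.
rewrite lEAS_otimes [comul _]fcomul_delta linear_sum (bigD1 h) //=.
rewrite tlift_otimes // deltaM eqxx scale1r big1 ?addr0 // => k /negPf kh.
by rewrite tlift_otimes // deltaM kh scale0r otimes0l.
Qed.

Lemma lEAS'_delta (g h : G) :
  lEAS'_map (delta K g ⊗ delta K h) = delta K (h * g)%g ⊗ delta K g.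
Proof.
have bl : bilin (fun b1 b2 : funAlg K G => b1 ⊗ (antipode b2 * delta K g)).
  split=> [b k x y|a k x y] /=; first by rewrite otimesPl.
  by rewrite linearP mulrDl -scalerAl otimesPr.
have term k : tlift (fun b1 b2 : funAlg K G => b1 ⊗ (antipode b2 * delta K g))
    (delta K k ⊗ delta K (k^-1 * h)%g) =
    (k == h * g)%g%:R *: (delta K k ⊗ delta K g).
  rewrite tlift_otimes // [antipode _]fantipode_delta deltaM invMg invgK.
  (* The surviving index solves k^-1 h = g^-1, inverted to h^-1 k = g. *)
  rewrite -(inj_eq (mulgI h)) mulKVg.
  have [->|_] := eqVneq k (h * g)%g; first by rewrite mulKg linearZ.
  by rewrite linearZ /= !scale0r.
rewrite lEAS'_otimes [comul _]fcomul_delta linear_sum (bigD1 (h * g)%g) //= term.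
rewrite eqxx scale1r big1 ?addr0 // => k /negPf kh.
by rewrite term kh scale0r.
Qed.

End BasisFormulas.

Theorem corollary5p20 (K : fieldType) (G : finGroupType) :
  lpair_iso (lEAS' (groupAlg K G)) (lEAS (funAlg K G)) /\
  lpair_iso (lEAS' (funAlg K G)) (lEAS (groupAlg K (opg G))).
Proof.
have bij_id : bijective (id : G -> G) by exists id.
have bij_op : bijective (id : G -> opg G) by exists id.
split.
- exact (lpair_iso_of_basis bij_id (@lEAS'_gelt K G) (@lEAS_delta K G)).
- exact (lpair_iso_of_basis bij_op (@lEAS'_delta K G) (@lEAS_gelt K (opg G))).
Qed.
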